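(* Let $q$ be a prime power and let $\mathscr{S}_T$ be a tangent splash of $\ell_\infty$ in $\mathrm{PG}(2,q^3)$ with centre $T$. Let $\ell$ be an order-$q$-subline disjoint from $\ell_\infty$ and contained in a line of $\mathrm{PG}(2,q^3)$ which meets $\ell_\infty$ in a point of $\mathscr{S}_T\setminus\{T\}$. Then there is a unique order-$q$-subplane meeting $\ell_\infty$ in exactly one point that contains $\ell$ and has tangent splash $\mathscr{S}_T$.
   Context: An order-$q$-subplane of $\mathrm{PG}(2,q^3)$ is a subplane of order $q$ (an image of $\mathrm{PG}(2,q)$ under $\mathrm{PGL}(3,q^3)$). An order-$q$-subline of a line is an image of $\mathrm{PG}(1,q)$ under $\mathrm{PGL}(2,q^3)$ (equivalently, a line of some order-$q$-subplane). $\ell_\infty$ is a fixed line. If $\pi$ is an order-$q$-subplane meeting $\ell_\infty$ in exactly one point $T$, its tangent splash is the set of $q^2+1$ points of $\ell_\infty$ lying on the extension of some line of $\pi$; $T$ is its centre. A tangent splash of $\ell_\infty$ with centre $T$ is any set arising this way. *)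

(* Defs.v *)
From HB Require Import structures.
From mathcomp Require Import all_boot all_order all_algebra.

Set Implicit Arguments.
Unset Strict Implicit.
Unset Printing Implicit Defensive.

Import GRing.Theory.
Local Open Scope ring_scope.

(* The subspaces of a vector space over a finite field form a finite type,
   which gives access to {set _}, #|_| and [exists _, _] on them. *)
HB.instance Definition _ (F : finFieldType) (vT : vectType F) :=
  CanIsCountable (@VectorInternalTheory.vs2mxK F vT).
HB.instance Definition _ (F : finFieldType) (vT : vectType F) :
    isFinite {vspace vT} :=
  CanIsFinite (@VectorInternalTheory.vs2mxK F vT).

Definition prime_power (q : nat) : Prop :=
  exists p e : nat, [/\ prime p, (0 < e)%N & q = (p ^ e)%N].

(* The d-dimensional projective subspaces of PG(n, F) are the vector subspaces
   of F^(n+1) of dimension d + 1, ordered by inclusion. *)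
Definition flat (F : finFieldType) (n d : nat) :=
  {U : {vspace 'rV[F]_n.+1} | \dim U == d.+1}.

Notation point F n := (flat F n 0).
Notation line F n := (flat F n 1).

Definition points_on (F : finFieldType) (n : nat) (L : line F n) :
    {set point F n} :=
  [set P : point F n | (val P <= val L)%VS].

(* The F-span of the image of the K-subspace U under u |-> u *m A, where K is
   regarded as a subfield of F through iota. *)
Definition extend (K F : finFieldType) (iota : {rmorphism K -> F}) (m n : nat)
    (A : 'M[F]_(m.+1, n.+1)) (U : {vspace 'rV[K]_m.+1}) :
    {vspace 'rV[F]_n.+1} :=
  <<[seq map_mx iota u *m A | u : 'rV[K]_m.+1 in U]>>%VS.

(* The d-dimensional flats of the image of PG(m, K) in PG(n, F) under A, each
   one identified with its extension to PG(n, F). *)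
Definition image_flats (K F : finFieldType) (iota : {rmorphism K -> F})
    (m n : nat) (A : 'M[F]_(m.+1, n.+1)) (d : nat) : {set flat F n d} :=
  [set X : flat F n d |
    [exists Y : flat K m d, val X == extend iota A (val Y)]].

(* A set of points and a set of (extended) lines of PG(2, F). *)
Record configuration (F : finFieldType) := Configuration {
  points : {set point F 2};
  lines : {set line F 2}
}.

(* Elements of PGL(3, F) are represented by invertible matrices. *)
Definition subplane (K F : finFieldType) (iota : {rmorphism K -> F})
    (pi : configuration F) : Prop :=
  exists2 A : 'M[F]_3, A \in unitmx &
    pi = Configuration (image_flats iota A 0) (image_flats iota A 1).

(* The matrices of full rank in 'M_(2, 3) are the coordinatisations by PG(1, F)
   of the lines of PG(2, F); composing a fixed one with all of PGL(2, F) gives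
   all those that have the same row space. *)
Definition subline (K F : finFieldType) (iota : {rmorphism K -> F})
    (l : {set point F 2}) : Prop :=
  exists2 B : 'M[F]_(2, 3), row_free B & l = image_flats iota B 0.

Definition splash (F : finFieldType) (linf : line F 2) (pi : configuration F) :
    {set point F 2} :=
  [set X in points_on linf | [exists L in lines pi, X \in points_on L]].

Definition tangent_splash (K F : finFieldType) (iota : {rmorphism K -> F})
    (linf : line F 2) (T : point F 2) (S : {set point F 2}) : Prop :=
  exists pi : configuration F,
    [/\ subplane iota pi,
        points pi :&: points_on linf = [set T]
      & S = splash linf pi].

(* Main.v *)
Require Import Defs.
From HB Require Import structures.
From mathcomp Require Import all_boot all_order all_algebra ring.

(* Write K and F for the fields of order q and q^3, and linf as the kernel of a
   linear form h. A subplane tangent to linf at <a> is spanned over K by vectors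
   a, e, f with h a = 0, h e = 1 and h f = t outside K, and its splash consists
   of <a> and of the points <b + z a> with b = t e - f and z in K + K t.
   Since t is cubic over K, the inverses of the elements of K + K t do not form
   a K-plane, so the splash determines its centre <a>. The subline l provides
   e and f and, because its line meets linf in a point of the splash, fixes <b>.
   A subplane through l with centre <a> is then spanned by x a, e, f for some x
   in F, and its splash is the given one iff x maps K + K h(f) onto a prescribed
   K-plane of F. As any two K-planes spanned by 1 and an element of F \ K differ
   by a factor that is unique up to K*, such a subplane exists and is unique. *)

Set Implicit Arguments.
Unset Strict Implicit.

Import GRing.Theory.

(** * The [K]-planes [K + K t] in a cubic extension [F] of [K] *)

Section CubicExtension.
Local Open Scope ring_scope.
Variables (K F : finFieldType) (iota : {rmorphism K -> F}).
Implicit Types (t x y z g mu nu : F) (k r s : K).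

Definition Kplane (t : F) : {set F} :=
  [set iota p.1 * t + iota p.2 | p : K * K].

Lemma KplaneP t z :
  reflect (exists r s, z = iota r * t + iota s) (z \in Kplane t).
Proof.
apply: (iffP imsetP) => [[[r s] _ ->]|[r [s ->]]]; first by exists r, s.
by exists (r, s).
Qed.

Lemma Kplane_comb r s t : iota r * t + iota s \in Kplane t.
Proof. by apply/KplaneP; exists r, s. Qed.

Lemma KplaneD t y z : y \in Kplane t -> z \in Kplane t -> y + z \in Kplane t.
Proof.
move=> /KplaneP[r [s ->]] /KplaneP[r' [s' ->]].
by apply/KplaneP; exists (r + r'), (s + s'); rewrite !rmorphD; ring.
Qed.

Lemma KplaneZ t k z : z \in Kplane t -> iota k * z \in Kplane t.
Proof.
move=> /KplaneP[r [s ->]].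
by apply/KplaneP; exists (k * r), (k * s); rewrite !rmorphM; ring.
Qed.

Lemma KplaneN t z : z \in Kplane t -> - z \in Kplane t.
Proof. by move=> /(KplaneZ (-1)); rewrite rmorphN1 mulN1r. Qed.

Lemma Kplane1 t : 1 \in Kplane t.
Proof. by have := Kplane_comb 0 1 t; rewrite rmorph0 rmorph1 mul0r add0r. Qed.

Lemma Kplane_gen t : t \in Kplane t.
Proof. by have := Kplane_comb 1 0 t; rewrite rmorph0 rmorph1 mul1r addr0. Qed.

Lemma Kplane_free t r s : t \notin codom iota ->
  iota r * t + iota s = 0 -> r = 0 /\ s = 0.
Proof.
move=> tK; have [->|r0] := eqVneq r 0.
  by rewrite rmorph0 mul0r add0r => /eqP; rewrite fmorph_eq0 => /eqP ->.
move/eqP; rewrite addr_eq0 => /eqP e; case/negP: tK.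
apply/codomP; exists (r^-1 * - s).
by rewrite rmorphM rmorphN -e fmorphV mulKf // fmorph_eq0.
Qed.

Lemma card_Kplane t : t \notin codom iota -> #|Kplane t| = (#|K| ^ 2)%N.
Proof.
move=> tK; rewrite card_imset ?card_prod // => -[r s] [r' s'] /= e.
have := @Kplane_free t (r - r') (s - s') tK; rewrite !rmorphB.
case=> [|/subr0_eq -> /subr0_eq -> //].
by rewrite mulrBl addrACA -opprD e subrr.
Qed.

(** The coordinates of the three elements with respect to [t] and 1 form a 3 by 2 matrix over [K],
    which has a nonzero left kernel. *)
Lemma Kplane_dep3 t (w : 'I_3 -> F) : (forall i, w i \in Kplane t) ->
  exists2 k : 'rV[K]_3, k != 0 & \sum_i iota (k 0 i) * w i = 0.
Proof.
move=> wt; have /fin_all_exists[r /fin_all_exists[s rs]] i :=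
  KplaneP _ _ (wt i).
pose M : 'M[K]_(3, 2) := \matrix_(i, j) (if j == 0 then r i else s i).
have : kermx M != 0.
  rewrite -mxrank_eq0 mxrank_ker -lt0n subn_gt0.
  exact: leq_ltn_trans (rank_leq_col M) _.
case/rowV0Pn=> k /sub_kermxP kM k0; exists k => //.
have eqM j : \sum_i k 0 i * (if j == 0 :> 'I_2 then r i else s i) = 0.
  by have /rowP/(_ j) := kM; rewrite !mxE => {2}<-; apply: eq_bigr => i _;
    rewrite mxE.
transitivity (iota (\sum_i k 0 i * r i) * t + iota (\sum_i k 0 i * s i)).
  rewrite !rmorph_sum /= mulr_suml -big_split /=; apply: eq_bigr => i _.
  by rewrite rs !rmorphM; ring.
by have := eqM 0; have := eqM 1 => /= -> ->; rewrite !rmorph0 mul0r add0r.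
Qed.

Hypothesis cardF : #|F| = (#|K| ^ 3)%N.

(* Otherwise Kplane t would be a field, and for x outside of it the sum
   Kplane t + x * Kplane t would have #|K| ^ 4 elements. *)
Lemma cubic_free t (a b d : K) : t \notin codom iota ->
  iota a * t ^+ 2 + iota b * t + iota d = 0 -> [/\ a = 0, b = 0 & d = 0].
Proof.
move=> tK abd; have [a0|a0] := eqVneq a 0.
  move: abd; rewrite a0 rmorph0 mul0r add0r => /(Kplane_free tK).
  by case=> -> ->.
exfalso; pose m := - (b / a); pose k := - (d / a).
have t2 : t ^+ 2 = iota m * t + iota k.
  apply: (mulfI (x := iota a)); first by rewrite fmorph_eq0.
  have am : iota a * iota m = - iota b.
    by rewrite -rmorphM mulrN mulrCA mulfV // mulr1 rmorphN.
  have ak : iota a * iota k = - iota d.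
    by rewrite -rmorphM mulrN mulrCA mulfV // mulr1 rmorphN.
  rewrite mulrDr [_ * (iota m * t)]mulrA am ak; apply/subr0_eq; rewrite -abd;
    ring.
have KM y z : y \in Kplane t -> z \in Kplane t -> y * z \in Kplane t.
  move=> /KplaneP[r [s ->]] /KplaneP[r' [s' ->]].
  apply/KplaneP; exists (r * r' * m + r * s' + s * r'), (r * r' * k + s * s').
  rewrite !rmorphD !rmorphM.
  transitivity (iota r * iota r' * t ^+ 2
    + (iota r * iota s' + iota s * iota r') * t + iota s * iota s').
    by ring.
  by rewrite t2; ring.
(* Multiplication by a nonzero [y] is injective on the finite set [Kplane t], hence permutes it and
   hits 1. *)
have KV y : y \in Kplane t -> y != 0 -> y^-1 \in Kplane t.
  move=> yt y0.
  have : [set y * z | z in Kplane t] == Kplane t.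
    rewrite eqEcard (card_imset _ (mulfI y0)).
    rewrite leqnn andbT; apply/subsetP => _ /imsetP[z zt ->]; exact: KM.
  move/eqP/setP/(_ 1); rewrite Kplane1 => /imsetP[z zt e].
  by rewrite -[y^-1]mulr1 e mulKf.
have q1 : (1 < #|K|)%N by exact: card_finNzRing_gt1.
have [x xt] : exists x, x \notin Kplane t.
  apply/existsP; rewrite -negb_forall; apply/negP => /forallP allK.
  have : (#|F| <= #|Kplane t|)%N by apply: subset_leq_card; apply/subsetP.
  by rewrite cardF card_Kplane // leq_exp2l.
pose g (p : F * F) := p.1 + x * p.2.
(* A collision with distinct second components would express [x] as a quotient of elements of the
   field [Kplane t]. *)
have gI : {in setX (Kplane t) (Kplane t) &, injective g}.
  move=> [y z] [y' z'] /setXP[/= yt zt] /setXP[/= yt' zt']; rewrite /g /= => e.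
  have e' : x * (z' - z) = y - y'.
    rewrite mulrBr; apply/subr0_eq; rewrite -[RHS](subrr (y + x * z)) {1}e.
    by ring.
  have [zz|zz] := eqVneq z' z.
    by move: e; rewrite zz => /addIr ->.
  rewrite -subr_eq0 in zz; case/negP: xt; rewrite -[x](mulfK zz) e'.
  by rewrite KM ?KV ?KplaneD ?KplaneN.
have : (#|g @: setX (Kplane t) (Kplane t)| <= #|F|)%N by apply: max_card.
by rewrite card_in_imset // cardsX card_Kplane // cardF -expnD leq_exp2l.
Qed.

(** Both planes have [#|K| ^ 2] elements and multiplication by [mu] is injective, so the inclusion
    is an equality. *)
Lemma Kplane_scale_eq t t' mu : t \notin codom iota -> t' \notin codom iota ->
  mu != 0 -> {in Kplane t', forall z, mu * z \in Kplane t} ->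
  Kplane t = [set mu * z | z in Kplane t'].
Proof.
move=> tK t'K mu0 sub; apply/esym/eqP; rewrite eqEcard.
rewrite (card_imset _ (mulfI mu0)) !card_Kplane // leqnn andbT.
by apply/subsetP => _ /imsetP[z zt ->]; exact: sub.
Qed.

(* As #|K| ^ 4 > #|F|, the map (y, z) |-> y * t' - z on pairs in Kplane t is not
   injective, which gives a nonzero mu with both mu and mu * t' in Kplane t. *)
Lemma Kplane_scale t t' : t \notin codom iota -> t' \notin codom iota ->
  exists2 mu, mu != 0 & {in Kplane t', forall z, mu * z \in Kplane t}.
Proof.
move=> tK t'K.
pose g (p : (K * K) * (K * K)) :=
  (iota p.1.1 * t + iota p.1.2) * t' - (iota p.2.1 * t + iota p.2.2).
have q1 : (1 < #|K|)%N by exact: card_finNzRing_gt1.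
have /injectivePn[[[r s] [m k]] [[[r' s'] [m' k']] ne]] : ~~ injectiveb g.
  apply/negP => /injectiveP gI.
  have : (#|g @: setT| <= #|F|)%N by apply: max_card.
  by rewrite card_imset // cardsT !card_prod cardF !mulnn -expnM leq_exp2l.
rewrite /g /= => e.
(* The collision reads [mu * t' = y] with [mu] and [y] in [Kplane t]. If [mu] were 0, so would be
   [y], and the two colliding pairs would coincide. *)
have e' : (iota (r - r') * t + iota (s - s')) * t' =
    iota (m - m') * t + iota (k - k').
  rewrite !rmorphB; apply/subr0_eq.
  rewrite -[RHS](subrr ((iota r * t + iota s) * t' - (iota m * t + iota k)))
    {2}e; ring.
exists (iota (r - r') * t + iota (s - s')).
  apply: contraNneq ne => e0; rewrite e0 mul0r in e'.
  have [/subr0_eq -> /subr0_eq ->] := Kplane_free tK e0.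
  by have [/subr0_eq -> /subr0_eq ->] := Kplane_free tK (esym e').
move=> _ /KplaneP[a [b ->]].
rewrite mulrDr mulrCA e' [_ * iota b]mulrC.
by rewrite KplaneD ?KplaneZ ?Kplane_comb.
Qed.

(** The quotient [w = nu / mu] stabilises [Kplane t']. Writing [w = r t' + s] and [w t' = m t' + k]
    gives a quadratic relation for [t'] over [K] with leading coefficient [r]. As [t'] is cubic,
    [r = 0] and [w] lies in [K]. *)
Lemma Kplane_scale_unique t t' mu nu :
  t \notin codom iota -> t' \notin codom iota -> mu != 0 -> nu != 0 ->
  {in Kplane t', forall z, mu * z \in Kplane t} ->
  {in Kplane t', forall z, nu * z \in Kplane t} ->
  exists k, nu = iota k * mu.
Proof.
move=> tK t'K mu0 nu0 mut nut.
have kW z : z \in Kplane t' -> nu / mu * z \in Kplane t'.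
  move=> /nut; rewrite (Kplane_scale_eq tK t'K mu0 mut) => /imsetP[y yt e].
  by rewrite mulrAC e [mu * y]mulrC mulfK.
have /KplaneP[r [s e]] := kW _ (Kplane1 _).
rewrite mulr1 in e; have /KplaneP[m [k e']] := kW _ (Kplane_gen t').
have [|r0 _ _] := @cubic_free t' r (s - m) (- k) t'K.
  rewrite rmorphN rmorphB; apply/subr0_eq.
  rewrite -[RHS](subrr (nu / mu * t')) {1}e e'; ring.
by exists s; rewrite -[nu](divfK mu0) e r0 rmorph0 mul0r add0r.
Qed.

(* The inverses of 1, t and t + 1 are K-independent. *)
Lemma Kplane_inv t t' g : t \notin codom iota -> g != 0 ->
  ~ {in Kplane t, forall z, z != 0 -> g / z \in Kplane t'}.
Proof.
move=> tK g0 inv.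
have t0 : t != 0 by apply: contraNneq tK => ->; rewrite -(rmorph0 iota) codom_f.
have t1 : t + 1 != 0.
  apply: contraNneq tK => /eqP; rewrite addr_eq0 => /eqP->.
  by rewrite -(rmorphN1 iota) codom_f.
pose w (i : 'I_3) := g / nth 0 [:: 1; t; t + 1] i.
have wt i : w i \in Kplane t'.
  by case: i => [[|[|[|]]] //= ?]; rewrite /w /= inv ?KplaneD ?Kplane1
    ?Kplane_gen ?oner_eq0.
have [k k0] := Kplane_dep3 wt; rewrite !big_ord_recl big_ord0 /w /=.
set a := k 0 _; set b := k 0 _; set d := k 0 _ => e.
(* Clearing denominators in [a / 1 + b / t + d / (t + 1) = 0] gives
   [a t^2 + (a + b + d) t + b = 0]. *)
have [|a0 ab0 b0] := @cubic_free t a (a + b + d) b tK.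
  rewrite !rmorphD; apply: (mulfI g0); rewrite mulr0.
  transitivity ((t * (t + 1)) *
    (iota a * (g / 1) + (iota b * (g / t) + (iota d * (g / (t + 1)) + 0)))).
    by (field; rewrite t1 t0 oner_eq0).
  by rewrite e mulr0.
case/eqP: k0; apply/rowP => i; rewrite mxE.
rewrite a0 b0 !add0r in ab0.
case: i => [[|[|[|]]] //= ?]; [rewrite -a0|rewrite -b0|rewrite -ab0];
  congr (k 0 _); exact: val_inj.
Qed.

End CubicExtension.

(** * Points by spanning vectors, hyperplanes by linear equations *)

Section ProjectiveSpace.
Local Open Scope ring_scope.
Variables (F : finFieldType) (n : nat).
Implicit Types (v w : 'rV[F]_n.+1) (c : 'cV[F]_n.+1).

Lemma flat_exists d (U : {vspace 'rV[F]_n.+1}) :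
  \dim U = d.+1 -> exists Y : flat F n d, val Y = U.
Proof. by move=> /eqP dU; exists (exist _ U dU). Qed.

Fact point_subproof v : v != 0 -> \dim <[v]>%VS == 1%N.
Proof. by rewrite dim_vline => ->. Qed.

Definition pt v (v0 : v != 0) : point F n :=
  exist _ <[v]>%VS (point_subproof v0).

Lemma pt_surj (P : point F n) : exists v (v0 : v != 0), P = pt v0.
Proof.
have U1 : \dim (val P) = 1%N by apply/eqP/(valP P).
have U0 : vpick (val P) != 0 by rewrite vpick0 -dimv_eq0 U1.
exists (vpick (val P)), U0; apply/val_inj/esym/eqP.
by rewrite eqEdim -memvE memv_pick U1 dim_vline U0.
Qed.

Lemma pt_eqP v w (v0 : v != 0) (w0 : w != 0) :
  reflect (exists2 k, k != 0 & v = k *: w) (pt v0 == pt w0).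
Proof.
apply: (iffP eqP) => [/(congr1 val)/= e|[k k0 e]].
  have /vlineP[k e'] : v \in <[w]>%VS by rewrite -e memv_line.
  by exists k => //; apply: contraNneq v0 => k0; rewrite e' k0 scale0r.
apply/val_inj/eqP; rewrite eqEdim /= !dim_vline v0 w0 leqnn andbT -memvE.
by rewrite e memvZ ?memv_line.
Qed.

Lemma pt_points_on v (v0 : v != 0) (L : line F n) :
  (pt v0 \in points_on L) = (v \in val L).
Proof. by rewrite inE memvE. Qed.

Definition hyperplane c : {vspace 'rV[F]_n.+1} := lker (linfun (mulmxr c)).

Lemma mem_hyperplane c v : (v \in hyperplane c) = (v *m c == 0).
Proof. by rewrite memv_ker lfunE. Qed.

Lemma dim_hyperplane c : c != 0 -> \dim (hyperplane c) = n.
Proof.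
move=> c0; pose f : 'Hom('rV[F]_n.+1, 'M[F]_1) := linfun (mulmxr c).
have := limg_ker_dim f fullv.
rewrite capfv dimvf dim_matrix mul1r -/(hyperplane c).
suff -> : \dim (limg f) = 1%N by rewrite addn1 => -[].
apply/eqP; rewrite eqn_leq lt0n dimv_eq0; apply/andP; split.
  by rewrite (leq_trans (dimvS (subvf _))) // dimvf dim_matrix.
apply: contraNneq c0 => im0; apply/eqP/colP => i.
have : (delta_mx 0 i : 'rV[F]_n.+1) *m c == 0.
  by rewrite -mem_hyperplane memv_ker -memv0 -im0 memv_img ?memvf.
by rewrite -rowE => /eqP/rowP/(_ 0); rewrite !mxE.
Qed.

(** The [n] vectors of a basis of [U] impose [n] linear conditions on the [n + 1] entries of [c], so
    a nonzero solution exists; equality then follows from dimensions. *)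
Lemma hyperplaneP (U : {vspace 'rV[F]_n.+1}) : \dim U = n ->
  exists2 c, c != 0 & U = hyperplane c.
Proof.
move=> dU; pose M : 'M[F]_(\dim U, n.+1) := \matrix_i (vbasis U)`_i.
have : kermx M^T != 0.
  rewrite -mxrank_eq0 mxrank_ker -lt0n subn_gt0.
  by rewrite (leq_ltn_trans (rank_leq_col M^T)) // dU.
case/rowV0Pn=> k /sub_kermxP kM k0.
have c0 : k^T != 0 by rewrite trmx_eq0.
exists k^T => //; apply/eqP; rewrite eqEdim dim_hyperplane // dU leqnn andbT.
rewrite -[U in (U <= _)%VS](span_basis (vbasisP U)); apply/span_subvP => u.
move=> /(nthP 0)[i]; rewrite size_tuple => iU <-.
rewrite mem_hyperplane -[_`_i](rowK (fun i : 'I_(\dim U) => (vbasis U)`_i)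
  (Ordinal iU)).
by rewrite -row_mul -[M *m _]trmxK trmx_mul trmxK kM trmx0 row0.
Qed.

End ProjectiveSpace.

(** * Subgeometries over [K]: change of basis, inclusion, lines and splashes *)

Section Subgeometry.
Local Open Scope ring_scope.
Variables (K F : finFieldType) (iota : {rmorphism K -> F}).
Local Notation "M ^f" := (map_mx iota M).

Lemma mem_extend m n (A : 'M[F]_(m.+1, n.+1)) (U : {vspace 'rV[K]_m.+1}) u :
  u \in U -> u^f *m A \in extend iota A U.
Proof. by move=> uU; apply: memv_span; apply: image_f. Qed.

Lemma extend_subP m n (A : 'M[F]_(m.+1, n.+1)) (U : {vspace 'rV[K]_m.+1})
    (V : {vspace 'rV[F]_n.+1}) :
  reflect {in U, forall u, u^f *m A \in V} (extend iota A U <= V)%VS.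
Proof.
apply: (iffP idP) => [sub u uU|sub]; first exact/(subvP sub)/mem_extend.
by apply/span_subvP => _ /imageP[u uU ->]; exact: sub.
Qed.

Lemma extend_line m n (A : 'M[F]_(m.+1, n.+1)) (u : 'rV[K]_m.+1) :
  extend iota A <[u]> = <[u^f *m A]>%VS.
Proof.
apply/eqP; rewrite eqEsubv -memvE mem_extend ?memv_line // andbT.
apply/extend_subP => _ /vlineP[k ->].
by rewrite map_mxZ -scalemxAl memvZ ?memv_line.
Qed.

Lemma mem_image_flats0 m n (A : 'M[F]_(m.+1, n.+1)) v (v0 : v != 0) :
  reflect (exists lam u, v = lam *: (u^f *m A))
          (pt v0 \in image_flats iota A 0).
Proof.
rewrite inE; apply: (iffP existsP) => [[Y]|[lam [u e]]].
  have [u [u0 ->]] := pt_surj Y; rewrite /= extend_line => /eqP e.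
  have /vlineP[lam ->] : v \in <[u^f *m A]>%VS by rewrite -e memv_line.
  by exists lam, u.
have u0 : u != 0.
  by apply: contraNneq v0 => u0; rewrite e u0 map_mx0 mul0mx scaler0.
exists (pt u0); rewrite /= extend_line eqEdim -memvE e memvZ ?memv_line //=.
by rewrite -e !dim_vline v0 leq_b1.
Qed.

(** [G] permutes the flats over [K], and [lam] is absorbed by the span over [F]. *)
Lemma image_flats_sub m n (A : 'M[F]_(m.+1, n.+1)) lam (G : 'M[K]_m.+1) d :
  lam != 0 -> G \in unitmx ->
  image_flats iota (lam *: (G^f *m A)) d \subset image_flats iota A d.
Proof.
move=> lam0 Gu; apply/subsetP => X; rewrite !inE => /existsP[Y /eqP ->].
pose f := linfun (mulmxr G) : 'End('rV[K]_m.+1).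
have fE u : f u = u *m G by rewrite lfunE.
have f0 : lker f == 0%VS.
  by apply/lker0P => u w; rewrite !fE; apply: (can_inj (mulmxK Gu)).
have [|Z ZE] := @flat_exists K m d (f @: val Y)%VS.
  by rewrite limg_dim_eq ?(eqP f0) ?capv0 //; apply/eqP/(valP Y).
apply/existsP; exists Z; rewrite ZE eqEsubv.
apply/andP; split; apply/extend_subP => u uY.
  rewrite -scalemxAr memvZ // mulmxA -map_mxM -fE; apply: mem_extend.
  exact: memv_img.
have /memv_imgP[w wY ->] := uY; rewrite fE map_mxM -mulmxA.
rewrite -[_ *m _](scalerK lam0) memvZ // scalemxAr.
exact: mem_extend.
Qed.

Lemma image_flats_eq m n (A : 'M[F]_(m.+1, n.+1)) lam (G : 'M[K]_m.+1) d :
  lam != 0 -> G \in unitmx ->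
  image_flats iota (lam *: (G^f *m A)) d = image_flats iota A d.
Proof.
move=> lam0 Gu; apply/eqP; rewrite eqEsubset image_flats_sub //=.
rewrite -{1}[A](_ : lam^-1 *: ((invmx G)^f *m (lam *: (G^f *m A))) = A).
  by rewrite image_flats_sub ?invr_eq0 ?unitmx_inv.
by rewrite -scalemxAr scalerA mulVf // scale1r mulmxA -map_mxM mulVmx //
  map_mx1 mul1mx.
Qed.

(* Comparing the coefficients of the rows of B with those of their sum shows
   that all rows are K-combinations of the rows of A up to one common factor. *)
Lemma image_flats0_sub m n (A : 'M[F]_n.+1) (B : 'M[F]_(m.+1, n.+1)) :
  A \in unitmx -> row_free B ->
  image_flats iota B 0 \subset image_flats iota A 0 ->
  exists lam U, B = lam *: (U^f *m A).
Proof.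
move=> Au Bf sub.
have row_ex (y : 'rV[K]_m.+1) : exists lam u, y^f *m B = lam *: (u^f *m A).
  have [->|v0] := eqVneq (y^f *m B) 0; first by exists 0, 0; rewrite scale0r.
  apply/(mem_image_flats0 A v0)/(subsetP sub)/(mem_image_flats0 B v0).
  by exists 1, y; rewrite scale1r.
have /fin_all_exists[l /fin_all_exists[u lu]] i := row_ex (delta_mx 0 i).
pose U := \matrix_i u i; pose D := diag_mx (\row_i l i).
have BE : B = D *m U^f *m A.
  apply/row_matrixP => i; rewrite !row_mul row_diag_mx mxE -scalemxAl -rowE.
  by rewrite -map_row rowK -scalemxAl -lu map_delta_mx -rowE.
(* Freeness gives [U] a right inverse [V] over [K]; cancelling [U^f] with it turns the relation for
   the sum of the rows into [l i = lam * iota k]. *)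
have Uf : row_free U.
  rewrite -(row_free_map iota) /row_free eqn_leq rank_leq_row.
  rewrite -[X in (X <= _)%N](eqP Bf) BE.
  by rewrite (leq_trans (mxrankM_maxl _ _)) ?mxrankM_maxr.
have [V UV] := row_freeP Uf; have [lam [w lw]] := row_ex (const_mx 1).
have lK i : exists k, l i = lam * iota k.
  have : \row_i l i *m U^f = lam *: w^f.
    apply: (can_inj (mulmxK Au)); rewrite -scalemxAl -lw BE mulmxA;
      congr (_ *m _).
    rewrite mulmxA; congr (_ *m _); apply/rowP => j;
      rewrite mul_mx_diag !mxE rmorph1 mul1r //.
  move=> /(congr1 (mulmx^~ V^f)); rewrite -mulmxA -map_mxM UV map_mx1 mulmx1.
  rewrite -scalemxAl -map_mxM => /rowP/(_ i); rewrite !mxE => ->.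
  by eexists.
have /fin_all_exists[k lk] := lK.
exists lam, (diag_mx (\row_i k i) *m U); rewrite BE scalemxAl; congr (_ *m _).
rewrite map_mxM scalemxAl; congr (_ *m _); apply/matrixP => i j;
  rewrite !mxE lk.
by rewrite rmorphMn mulrnAr.
Qed.

(* If c_j != 0, then y = \sum_i y_i (e_i - c_i / c_j e_j) for y in ker c. *)
Lemma extend_hyperplane n (A : 'M[F]_n.+1) (c : 'cV[K]_n.+1) :
  A \in unitmx -> c != 0 ->
  extend iota A (hyperplane c) = hyperplane (invmx A *m c^f).
Proof.
move=> Au /matrix0Pn[j [i']]; rewrite ord1 => cj {i'}.
apply/eqP; rewrite eqEsubv; apply/andP; split.
  apply/extend_subP => u; rewrite !mem_hyperplane mulmxA mulmxK // -map_mxM.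
  by move=> /eqP ->; rewrite map_mx0.
apply/subvP => v; rewrite mem_hyperplane mulmxA => /eqP.
set y := v *m _ => yc; have -> : v = y *m A by rewrite mulmxKV.
pose u i : 'rV[K]_n.+1 := delta_mx 0 i - (c i 0 / c j 0) *: delta_mx 0 j.
have -> : y = \sum_i y 0 i *: (u i)^f.
  transitivity (y - ((y *m c^f) 0 0 / iota (c j 0)) *: delta_mx 0 j).
    by rewrite yc mxE mul0r scale0r subr0.
  rewrite {1}[y]row_sum_delta mxE mulr_suml scaler_suml -sumrB.
  apply: eq_bigr => i _; rewrite map_mxB map_mxZ !map_delta_mx scalerBr scalerA.
  by rewrite [c^f i 0]mxE rmorphM fmorphV mulrA.
rewrite mulmx_suml memv_suml // => i _; rewrite -scalemxAl memvZ //.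
rewrite mem_extend //.
rewrite mem_hyperplane mulmxBl -scalemxAl -!rowE; apply/eqP/matrixP => ? ?.
by rewrite !ord1 !mxE divfK // subrr.
Qed.

Lemma subplane_image_lines (A : 'M[F]_3) (L : line F 2) : A \in unitmx ->
  reflect (exists2 c : 'cV[K]_3, c != 0 & val L = hyperplane (invmx A *m c^f))
          (L \in image_flats iota A 1).
Proof.
move=> Au; rewrite inE; apply: (iffP existsP) => [[Y /eqP ->]|[c c0 ->]].
  have [c c0 e] := hyperplaneP (eqP (valP Y)); exists c => //.
  by rewrite e extend_hyperplane.
have [Y YE] := flat_exists (dim_hyperplane c0).
by exists Y; rewrite YE extend_hyperplane.
Qed.

Lemma pt_splash (linf : line F 2) (A : 'M[F]_3) v (v0 : v != 0) :
  A \in unitmx ->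
  reflect (v \in val linf /\
           exists2 c : 'cV[K]_3, c != 0 & v *m invmx A *m c^f = 0)
    (pt v0 \in splash linf
       (Configuration (image_flats iota A 0) (image_flats iota A 1))).
Proof.
move=> Au; rewrite inE pt_points_on; apply: (iffP andP) => -[vinf].
  case/existsP=> L /andP[/(subplane_image_lines _ Au)[c c0 LE]].
  rewrite pt_points_on LE mem_hyperplane mulmxA => /eqP vc.
  by split=> //; exists c.
case=> c c0 vc; split=> //; apply/existsP.
have [|L LE] := @flat_exists F 2 1 (hyperplane (invmx A *m c^f)).
  rewrite dim_hyperplane //; apply: contraNneq c0 => /(congr1 (mulmx A)).
  by rewrite mulmx0 mulKVmx // => /eqP; rewrite map_mx_eq0.
exists L; rewrite pt_points_on LE mem_hyperplane mulmxA vc eqxx andbT.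
by apply/(subplane_image_lines _ Au); exists c.
Qed.

End Subgeometry.

(** * Bases of three vectors, and tangent splashes as cones *)

Section Frames.
Local Open Scope ring_scope.

Definition mat3 (R : nzRingType) (a e f : 'rV[R]_3) : 'M[R]_3 :=
  \matrix_(i < 3) [:: a; e; f]`_i.

Definition row3 (R : nzRingType) (x y z : R) : 'rV[R]_3 :=
  \row_(i < 3) [:: x; y; z]`_i.

Lemma mat3_rows (R : nzRingType) (A : 'M[R]_3) :
  A = mat3 (row 0 A) (row 1 A) (row ord_max A).
Proof.
apply/row_matrixP => i; rewrite rowK.
by case: i => [[|[|[|]]] //= ?]; congr row; apply: val_inj.
Qed.

Lemma mulmx_mat3 (R : nzRingType) (u a e f : 'rV[R]_3) :
  u *m mat3 a e f = u 0 0 *: a + u 0 1 *: e + u 0 ord_max *: f.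
Proof.
rewrite mulmx_sum_row !big_ord_recl big_ord0 !rowK /= addr0 addrA.
by congr (_ + u 0 _ *: _ + u 0 _ *: _); apply: val_inj.
Qed.

Lemma row3_mat3 (R : nzRingType) x y z (a e f : 'rV[R]_3) :
  row3 x y z *m mat3 a e f = x *: a + y *: e + z *: f.
Proof. by rewrite mulmx_mat3 !mxE. Qed.

Lemma mulmx_col3 (R : nzRingType) (u : 'rV[R]_3) (d : 'cV[R]_3) :
  (u *m d) 0 0 = u 0 0 * d 0 0 + u 0 1 * d 1 0 + u 0 ord_max * d ord_max 0.
Proof.
rewrite mxE !big_ord_recl big_ord0 /= addr0 addrA.
by congr (_ + u 0 _ * d _ 0 + u 0 _ * d _ 0); apply: val_inj.
Qed.

Definition indep (R : nzRingType) (V : lmodType R) (a b : V) :=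
  forall x y : R, x *: a + y *: b = 0 -> x = 0 /\ y = 0.

Lemma row3P (R : nzRingType) (u w : 'rV[R]_3) :
  u 0 0 = w 0 0 -> u 0 1 = w 0 1 -> u 0 ord_max = w 0 ord_max -> u = w.
Proof.
move=> e0 e1 e2; apply/rowP; case=> [[|[|[|]]] // i3].
- by rewrite (_ : Ordinal i3 = 0) //; apply: val_inj.
- by rewrite (_ : Ordinal i3 = 1) //; apply: val_inj.
- by rewrite (_ : Ordinal i3 = ord_max) //; apply: val_inj.
Qed.

Variables (K F : finFieldType) (iota : {rmorphism K -> F}).
Local Notation "M ^f" := (map_mx iota M).
Local Notation conf A :=
  (Configuration (image_flats iota A 0) (image_flats iota A 1)).
Implicit Types (t x y z : F) (a b e f v : 'rV[F]_3).

Lemma unit_mat3_free a e f x y z : mat3 a e f \in unitmx ->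
  x *: a + y *: e + z *: f = 0 -> [/\ x = 0, y = 0 & z = 0].
Proof.
move=> Au; rewrite -row3_mat3 => /(congr1 (mulmx^~ (invmx (mat3 a e f)))).
rewrite mulmxK // mul0mx => /rowP u0.
by split; [have := u0 0 | have := u0 1 | have := u0 ord_max]; rewrite !mxE.
Qed.

Lemma unit_mat3_neq0 a e f : mat3 a e f \in unitmx -> a != 0.
Proof.
move=> Au; apply/eqP => a0; have [|/eqP] :=
  unit_mat3_free (x := 1) (y := 0) (z := 0) Au.
  by rewrite a0 scaler0 !scale0r !addr0.
by rewrite oner_eq0.
Qed.

(* In homogeneous coordinates, the points <a> and <b + z a> with z in K + K t:
   a tangent splash with centre <a>. *)
Definition cone a b t v :=
  exists k, v = k *: a \/
    exists2 z, z \in Kplane iota t & v = k *: (b + z *: a).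

(** Since [Kplane] is an additive group, any point of the cone other than the centre can serve as
    base point. This allows the point where the line of [l] meets [linf] to be taken as [b]. *)
Lemma cone_shift a b t z v : z \in Kplane iota t ->
  cone a (b + z *: a) t v <-> cone a b t v.
Proof.
move=> zt; split=> -[k [->|[z' zt' ->]]]; exists k; (try by left); right.
  by exists (z + z'); rewrite ?KplaneD // scalerDl addrA.
exists (z' - z); first by rewrite KplaneD ?KplaneN.
by congr (_ *: _); rewrite scalerBl -[RHS]addrA subrKC.
Qed.

(* If there were a second centre, its coordinate could be taken to be 0, and
   then inverting the nonzero elements of a K-plane would give a K-plane. *)
Lemma cone_centre_unique a b t a' b' t' : #|F| = (#|K| ^ 3)%N ->
  t \notin codom iota -> indep a b -> indep a' b' -> a' != 0 ->
  (forall v, v != 0 -> cone a b t v <-> cone a' b' t' v) ->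
  exists2 k, k != 0 & a' = k *: a.
Proof.
move=> cardF tK ab ab' a'0 eqC.
have a0 : a != 0.
  apply/eqP => a0; have [|/eqP] := ab 1 0;
    first by rewrite a0 scaler0 scale0r addr0.
  by rewrite oner_eq0.
have [k [e|[z0 z0t e]]] : cone a b t a'.
  by apply/eqC => //; exists 1; left; rewrite scale1r.
  by exists k => //; apply: contraNneq a'0 => k0; rewrite e k0 scale0r.
have k0 : k != 0 by apply: contraNneq a'0 => k0; rewrite e k0 scale0r.
(* From here on [a'] is a noncentral point of the first cone; symmetrically, [a] is either the
   second centre or a noncentral point [k' (b' + z0' a')]. *)
have [k' [e'|[z0' z0t' e']]] : cone a' b' t' a.
  by apply/eqC => //; exists 1; left; rewrite scale1r.
  have k'0 : k' != 0 by apply: contraNneq a0 => k'0; rewrite e' k'0 scale0r.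
  by exists k'^-1; rewrite ?invr_eq0 // e' scalerK.
have k'0 : k' != 0 by apply: contraNneq a0 => k'0; rewrite e' k'0 scale0r.
have g0 : (k * k')^-1 != 0 by rewrite invr_eq0 mulf_neq0.
(* The point [b + (z0 + z) a = a' / k + z a] lies in the first cone, hence in the second. In terms
   of [a'] and [b'] its coefficient quotient is [z0' + 1 / (k k' z)], so [1 / (k k' z)] lies in
   [Kplane t'] for every nonzero [z] in [Kplane t]. *)
case: (@Kplane_inv _ _ iota cardF t t' _ tK g0) => z zt z0'0.
have vE : b + (z0 + z) *: a = (k^-1 + z * k' * z0') *: a' + (z * k') *: b'.
  transitivity (k^-1 *: a' + z *: a).
    by rewrite {1}e scalerK // scalerDl addrA.
  by rewrite [in LHS]e'; apply/rowP => j; rewrite !mxE; ring.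
have v0 : b + (z0 + z) *: a != 0.
  apply/eqP; rewrite addrC -[b]scale1r => /ab[_ /eqP]; by rewrite oner_eq0.
have /(eqC _ v0) : cone a b t (b + (z0 + z) *: a).
  by exists 1; right; exists (z0 + z); rewrite ?KplaneD ?scale1r.
rewrite vE => -[m [|[w wt]]] /eqP; rewrite -subr_eq0.
  rewrite addrAC -scalerBl => /eqP/ab'[_ /eqP].
  by rewrite mulf_eq0 (negPf z0'0) (negPf k'0).
rewrite (_ : _ - _ = (k^-1 + z * k' * z0' - m * w) *: a' + (z * k' - m) *: b').
  move=> /eqP/ab'[e1 /subr0_eq e2].
  rewrite (_ : _ / z = w - z0') ?KplaneD ?KplaneN //.
  apply: (mulfI (mulf_neq0 z0'0 k'0)); move: e1; rewrite -e2 => e1.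
  transitivity (k^-1); first by field; rewrite z0'0 k0.
  by apply/subr0_eq; rewrite -[RHS]e1; ring.
by apply/rowP => j; rewrite !mxE; ring.
Qed.

(** * Frames normalised with respect to a linear form vanishing on [linf] *)

Definition lform (c : 'cV[F]_3) v : F := (v *m c) 0 0.

Variables (linf : line F 2) (c : 'cV[F]_3).
Hypothesis linfE : val linf = hyperplane c.
Local Notation h := (lform c).

Lemma lformD v w : h (v + w) = h v + h w.
Proof. by rewrite /lform mulmxDl mxE. Qed.

Lemma lformZ k v : h (k *: v) = k * h v.
Proof. by rewrite /lform -scalemxAl mxE. Qed.

Lemma mem_linf v : (v \in val linf) = (h v == 0).
Proof.
rewrite linfE mem_hyperplane; apply/eqP/eqP => [vc|vc];
  first by rewrite /lform vc mxE.
by apply/rowP => j; rewrite ord1 [RHS]mxE.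
Qed.

Section Frame.
Variables (a e f : 'rV[F]_3) (t : F).
Hypotheses (ha : h a = 0) (he : h e = 1) (hf : h f = t).

Lemma frame_h x y z : h (x *: a + y *: e + z *: f) = y + z * t.
Proof. by rewrite !lformD !lformZ ha he hf; ring. Qed.

(** Applying [h] to a relation [x a + y e + z f = 0] gives [y = - z t], which leaves a relation
    between [a] and [t e - f]. *)
Lemma frame_unit : indep a (t *: e - f) -> mat3 a e f \in unitmx.
Proof.
move=> ab; rewrite -row_free_unit; apply: inj_row_free => u;
  rewrite mulmx_mat3 => u0.
have := frame_h (u 0 0) (u 0 1) (u 0 ord_max); rewrite u0 /lform mul0mx mxE.
move/esym/eqP; rewrite addr_eq0 => /eqP u1.
have [|u00 /eqP] := ab (u 0 0) (- u 0 ord_max).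
  by rewrite -[RHS]u0 u1; apply/rowP => j; rewrite !mxE; ring.
by rewrite oppr_eq0 => /eqP u02; apply: row3P;
  rewrite mxE // u1 u02 mul0r oppr0.
Qed.

Hypothesis Au : mat3 a e f \in unitmx.

Lemma frame_indep : indep a (t *: e - f).
Proof.
move=> x y xy; have [|-> _ /eqP] := @unit_mat3_free a e f x (y * t) (- y) Au.
  by rewrite -[RHS]xy; apply/rowP => j; rewrite !mxE; ring.
by rewrite oppr_eq0 => /eqP.
Qed.

Lemma pt_frame_image :
  pt (unit_mat3_neq0 Au) \in image_flats iota (mat3 a e f) 0.
Proof.
apply/mem_image_flats0; exists 1, (row3 1 0 0); rewrite mulmx_mat3 !mxE /=.
by rewrite rmorph1 rmorph0 !scale0r !addr0 !scale1r.
Qed.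

(** If [t] were in [K], then [<f - t e>] would be a second point of the subplane on [linf]. *)
Lemma tangent_notin_codom T :
  image_flats iota (mat3 a e f) 0 :&: points_on linf = [set T] ->
  t \notin codom iota.
Proof.
move=> eqT; apply/codomP => -[k tk].
have v0 : f - t *: e != 0.
  apply/eqP => v0; have [|_ _ /eqP] := @unit_mat3_free a e f 0 (- t) 1 Au.
    by rewrite -[RHS]v0 scale0r add0r scale1r scaleNr addrC.
  by rewrite oner_eq0.
have aT : pt (unit_mat3_neq0 Au) = T.
  by apply/set1P; rewrite -eqT inE pt_frame_image pt_points_on mem_linf ha eqxx.
have : pt v0 = T.
  apply/set1P; rewrite -eqT inE pt_points_on mem_linf; apply/andP; split.
    apply/mem_image_flats0; exists 1, (row3 0 (- k) 1);
      rewrite mulmx_mat3 !mxE /=.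
    by rewrite rmorph1 rmorph0 rmorphN -tk scale0r add0r !scale1r scaleNr addrC.
  by rewrite -scaleNr lformD lformZ he hf mulr1 subrr.
rewrite -aT => /eqP/pt_eqP[x _ vx].
have [|_ _ /eqP] := @unit_mat3_free a e f (- x) (- t) 1 Au.
  by rewrite !scaleNr -vx scale1r; apply/rowP => j; rewrite !mxE; ring.
by rewrite oner_eq0.
Qed.

Hypothesis tK : t \notin codom iota.

(** A point with coordinates [x, y, z] in [K] is on [linf] iff [y + z t = 0], and [t] outside [K]
    forces [y = z = 0]. *)
Lemma frame_tangent :
  image_flats iota (mat3 a e f) 0 :&: points_on linf =
  [set pt (unit_mat3_neq0 Au)].
Proof.
apply/eqP; rewrite eqEsubset sub1set in_setI pt_frame_image.
rewrite pt_points_on mem_linf ha eqxx !andbT.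
apply/subsetP => P.
have [v [v0 ->]] := pt_surj P.
rewrite in_setI pt_points_on mem_linf in_set1.
case/andP=> /mem_image_flats0[lam [u vE]] hv; apply/pt_eqP.
have lam0 : lam != 0 by apply: contraNneq v0 => l0; rewrite vE l0 scale0r.
rewrite vE lformZ mulf_eq0 (negPf lam0) /= mulmx_mat3 frame_h !mxE addrC in hv.
have /eqP/(Kplane_free tK)[u2 u1] := hv.
rewrite mulmx_mat3 !mxE u1 u2 rmorph0 !scale0r !addr0 scalerA in vE.
exists (lam * iota (u 0 0)) => //.
by apply: contraNneq v0 => l0; rewrite vE l0 scale0r.
Qed.

(** A point of [linf] has coordinates [(y0, - y2 t, y2)] in the frame, and it is on the [K]-line
    with equation [d] iff [d0 y0 = y2 (d1 t - d2)]. If [y2 = 0] it is the centre; otherwise [d0] is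
    nonzero as [t] is outside [K], and [y0 / y2] lies in [K + K t]. *)
Lemma pt_splash_frame v (v0 : v != 0) :
  pt v0 \in splash linf (conf (mat3 a e f)) <-> cone a (t *: e - f) t v.
Proof.
split.
  case/(pt_splash _ _ v0 Au); rewrite mem_linf => hv [d d0 vd].
  have := mulmxKV Au v; move: (v *m invmx _) vd => y vd /esym vE.
  rewrite mulmx_mat3 in vE; rewrite vE frame_h addr_eq0 in hv.
  move/eqP: hv => y1; rewrite y1 in vE.
  have := mulmx_col3 y d^f; rewrite vd !mxE => /esym yd.
  have [y2|y2] := eqVneq (y 0 ord_max) 0.
    exists (y 0 0); left.
    by rewrite vE y2 mul0r oppr0 !scale0r !addr0.
  rewrite y1 in yd; have dE : y 0 0 * iota (d 0 0) =
      y 0 ord_max * (iota (d 1 0) * t + iota (- d ord_max 0)).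
    by rewrite rmorphN; apply/subr0_eq; rewrite -[RHS]yd; ring.
  have d00 : iota (d 0 0) != 0.
    apply: contraNneq d0 => d00; move: dE; rewrite d00 mulr0 => /esym/eqP.
    rewrite mulf_eq0 (negPf y2) /= => /eqP/(Kplane_free tK)[d1 /eqP].
    rewrite oppr_eq0 => /eqP d2.
    have /eqP := d00; rewrite fmorph_eq0 => /eqP d0.
    by rewrite -[d]trmxK trmx_eq0; apply/eqP/row3P; rewrite !mxE.
  have y0E : y 0 0 = y 0 ord_max *
      (iota (d 1 0 / d 0 0) * t - iota (d ord_max 0 / d 0 0)).
    apply: (mulIf d00); rewrite dE !rmorphM rmorphN fmorphV.
    by (field; rewrite d00).
  exists (- y 0 ord_max); right.
  exists (iota (- (d 1 0 / d 0 0)) * t + iota (d ord_max 0 / d 0 0)).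
    exact: Kplane_comb.
  by rewrite vE y0E rmorphN; apply/rowP => j; rewrite !mxE; ring.
case=> k [vE|[z /KplaneP[r [s zE]] vE]]; apply/pt_splash => //; split.
- by rewrite mem_linf vE lformZ ha mulr0.
(* The centre lies on the line spanned by [a] and [f]. *)
- exists (row3 0 1 0)^T.
    by apply/eqP => /matrixP/(_ 1 0)/eqP; rewrite !mxE oner_eq0.
  have -> : v = row3 k 0 0 *m mat3 a e f by rewrite row3_mat3 !scale0r !addr0.
  apply/matrixP => i j; rewrite mulmxK // !ord1 mulmx_col3 !mxE /=.
  by rewrite rmorph0; ring.
- by rewrite mem_linf vE lformZ lformD lformZ ha lformD lformZ -scaleN1r lformZ
  he hf; apply/eqP; ring.
(* The point has coordinates proportional to [(z, t, -1)], and [z - r t - s = 0]. *)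
exists (row3 1 (- r) s)^T.
  by apply/eqP => /matrixP/(_ 0 0)/eqP; rewrite !mxE oner_eq0.
have -> : v = row3 (k * z) (k * t) (- k) *m mat3 a e f.
  by rewrite row3_mat3 vE; apply/rowP => j; rewrite !mxE; ring.
apply/matrixP => i j; rewrite mulmxK // !ord1 mulmx_col3 !mxE /=.
by rewrite rmorph1 rmorphN zE; ring.
Qed.

End Frame.

Lemma scale_mat3 x a e f :
  x *: mat3 a e f = mat3 (x *: a) (x *: e) (x *: f).
Proof.
apply/row_matrixP => i; rewrite linearZ /= !rowK.
by case: i => [[|[|[|]]]].
Qed.

(** A change of basis over [K] makes the first row of the matrix represent [T]; a common factor from
    [F] then normalises [h e] to 1. Neither operation changes the subplane. *)
Lemma frame_exists A T : A \in unitmx ->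
  image_flats iota A 0 :&: points_on linf = [set T] ->
  exists a e f, [/\ [/\ h a = 0, h e = 1 & h f \notin codom iota],
    mat3 a e f \in unitmx, forall a0 : a != 0, pt a0 = T &
    forall d, image_flats iota (mat3 a e f) d = image_flats iota A d].
Proof.
move=> Au eqT; have [v [v0 TE]] := pt_surj T.
have /setIP[] : T \in image_flats iota A 0 :&: points_on linf.
  by rewrite eqT set11.
rewrite TE pt_points_on mem_linf => /mem_image_flats0[lam [u vE]] /eqP hv.
(* Gaussian elimination of the single row [u] yields an invertible matrix over [K] whose first row
   spans the same point as [u]. *)
pose G := row_ebase u; have Gu : G \in unitmx by apply: row_ebase_unit.
have [k uE] : exists k, u = k *: row 0 G.
  exists (col_ebase u 0 0 * (0 < \rank u)%N%:R).
  rewrite -{1}[u]mulmx_ebase mulmx_sum_row (bigD1 0) //= big1 ?addr0 => [|i i0].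
    by rewrite !mxE big_ord1 !mxE.
  rewrite !mxE big_ord1 !mxE eq_sym -[_ == _]/(i == 0) (negPf i0) mulr0.
  by rewrite scale0r.
pose A1 := G^f *m A.
have A1u : A1 \in unitmx by rewrite unitmx_mul map_unitmx Gu Au.
set a := row 0 A1; set e := row 1 A1; set f := row ord_max A1.
have AE : A1 = mat3 a e f by apply: mat3_rows.
have vaE : v = (lam * iota k) *: a.
  by rewrite vE uE map_mxZ -scalemxAl scalerA map_row -row_mul.
have k0 : lam * iota k != 0 by apply: contraNneq (v0) => l0;
  rewrite vaE l0 scale0r.
have ha : h a = 0.
  by apply/eqP; move/eqP: hv; rewrite vaE lformZ mulf_eq0 (negPf k0).
have AE1 d x : x != 0 ->
    image_flats iota (x *: mat3 a e f) d = image_flats iota A d.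
  by move=> x0; rewrite -AE image_flats_eq.
have e0 : e != 0.
  apply/eqP => e0; have [||_ /eqP] := @unit_mat3_free a e f 0 1 0.
  - by rewrite -AE.
  - by rewrite e0 !scale0r scaler0 !addr0.
  by rewrite oner_eq0.
(* Otherwise [<e>] would be a second point of the subplane on [linf]. *)
have he : h e != 0.
  apply/eqP => he; have : pt e0 = T.
    apply/set1P; rewrite -eqT inE pt_points_on mem_linf he eqxx andbT.
    by apply/mem_image_flats0; exists 1, (row 1 G);
      rewrite scale1r map_row -row_mul.
  rewrite TE => /eqP/pt_eqP[x _]; rewrite vaE scalerA => eE.
  have [||_ /eqP] := @unit_mat3_free a e f (- (x * (lam * iota k))) 1 0.
  - by rewrite -AE.
  - by rewrite scaleNr -eE scale0r addr0 scale1r addNr.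
  by rewrite oner_eq0.
pose x := (h e)^-1; have x0 : x != 0 by rewrite invr_eq0.
have Mu : mat3 (x *: a) (x *: e) (x *: f) \in unitmx.
  by rewrite -scale_mat3 unitmxZ ?unitfE // -AE.
have ha' : h (x *: a) = 0 by rewrite lformZ ha mulr0.
have he' : h (x *: e) = 1 by rewrite lformZ mulVf.
exists (x *: a), (x *: e), (x *: f); split.
- split=> //; apply: (@tangent_notin_codom _ _ _ _ ha' he' erefl Mu T).
  by rewrite -scale_mat3 AE1.
- exact: Mu.
- move=> a0; apply/eqP/pt_eqP; exists (x / (lam * iota k)).
    by rewrite mulf_neq0 ?invr_eq0.
  by rewrite vaE scalerA divfK.
by move=> d; rewrite -scale_mat3 AE1.
Qed.

(** * Comparison of cones with the same centre and base point *)

Lemma indepZ a b x : x != 0 -> indep a b -> indep (x *: a) b.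
Proof.
move=> x0 ab y z; rewrite scalerA => /ab[/eqP].
by rewrite mulf_eq0 (negPf x0) orbF => /eqP.
Qed.

(** The vector [nu b + z mu nu a] is [nu (b + (mu z) a)], and [mu z] runs through [Kplane t] as [z]
    runs through [Kplane t']. This is the existence half of the argument. *)
Lemma cone_scale a b t t' mu nu v :
  t \notin codom iota -> t' \notin codom iota -> mu != 0 -> nu != 0 ->
  {in Kplane iota t', forall z, mu * z \in Kplane iota t} ->
  cone ((mu * nu) *: a) (nu *: b) t' v <-> cone a b t v.
Proof.
move=> tK t'K mu0 nu0 mut; split=> -[k [->|[z zt ->]]].
- by exists (k * (mu * nu)); left; rewrite scalerA.
- exists (k * nu); right; exists (mu * z); first exact: mut.
  by apply/rowP => j; rewrite !mxE; ring.
- by exists (k / (mu * nu)); left; rewrite scalerA divfK ?mulf_neq0.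
move: zt; rewrite (Kplane_scale_eq tK t'K mu0 mut) => /imsetP[y yt ->].
exists (k / nu); right; exists y => //.
by apply/rowP => j; rewrite !mxE; field.
Qed.

(** A converse to [cone_scale], for uniqueness: comparing coefficients in
    [nu b + z x a = k (b + w a)] gives [k = nu] and [x / nu * z = w]. *)
Lemma cone_scale_sub a b t t' x nu : indep a b -> nu != 0 ->
  (forall v, v != 0 -> cone (x *: a) (nu *: b) t' v -> cone a b t v) ->
  {in Kplane iota t', forall z, x / nu * z \in Kplane iota t}.
Proof.
move=> ab nu0 sub z zt; have v0 : nu *: b + z *: (x *: a) != 0.
  apply/eqP; rewrite scalerA addrC => /ab[_ /eqP]; exact/negP.
have [|k [|[w wt]]] := sub _ v0; first by exists 1; right; exists z;
  rewrite ?scale1r.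
  move=> /eqP; rewrite -subr_eq0 (_ : _ - _ = (z * x - k) *: a + nu *: b).
    by move=> /eqP/ab[_ /eqP]; rewrite (negPf nu0).
  by apply/rowP => j; rewrite !mxE; ring.
move=> /eqP; rewrite -subr_eq0.
rewrite (_ : _ - _ = (z * x - k * w) *: a + (nu - k) *: b); last first.
  by apply/rowP => j; rewrite !mxE; ring.
move=> /eqP/ab[/subr0_eq zx /subr0_eq nuk].
by rewrite mulrAC [x * z]mulrC zx -nuk mulrAC divff // mul1r.
Qed.

(** Scaling one frame vector by an element of [K] is a diagonal change of basis over [K]. Hence a
    factor determined only up to [K*] still determines the subplane. *)
Lemma image_flats_mat3Z a e f k d : k != 0 ->
  image_flats iota (mat3 (iota k *: a) e f) d = image_flats iota (mat3 a e f) d.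
Proof.
move=> k0; pose G := diag_mx (row3 k 1 1).
have Gu : G \in unitmx.
  by rewrite unitmxE det_diag !big_ord_recl big_ord0 !mxE /= !mulr1 unitfE.
rewrite -[RHS](image_flats_eq _ _ _ (oner_neq0 F) Gu) scale1r;
  congr (image_flats iota _ d).
apply/row_matrixP => i; rewrite row_mul rowK map_diag_mx row_diag_mx.
rewrite -scalemxAl -rowE rowK !mxE.
by case: i => [[|[|[|]]] //= ?]; rewrite rmorph1 scale1r.
Qed.

(** * Sublines disjoint from [linf] and the subplanes through them *)

Definition mat2 e f : 'M[F]_(2, 3) := \matrix_(i < 2) [:: e; f]`_i.

Lemma mulmx_mat2 (u : 'rV[F]_2) e f : u *m mat2 e f = u 0 0 *: e + u 0 1 *: f.
Proof.
rewrite mulmx_sum_row !big_ord_recl big_ord0 !rowK /= addr0.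
by congr (_ + u 0 _ *: _); apply: val_inj.
Qed.

Lemma mat2_rows (B : 'M[F]_(2, 3)) : B = mat2 (row 0 B) (row 1 B).
Proof.
apply/row_matrixP => i; rewrite rowK.
by case: i => [[|[|]] //= ?]; congr row; apply: val_inj.
Qed.

Lemma mat2_free e f x y : row_free (mat2 e f) ->
  x *: e + y *: f = 0 -> x = 0 /\ y = 0.
Proof.
move=> Bf xy; pose u : 'rV[F]_2 := \row_i [:: x; y]`_i.
have /(row_free_inj Bf)/rowP u0 : u *m mat2 e f = 0 *m mat2 e f.
  by rewrite mul0mx mulmx_mat2 !mxE.
by split; [have := u0 0|have := u0 1]; rewrite !mxE.
Qed.

(** As [l] misses [linf], the first row can be scaled to have [h e = 1]. The vector [h f *: e - f]
    spans the point of [m] on [linf], hence is a multiple of [b]; for [h f] in [K] that point would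
    belong to [l]. *)
Lemma subline_frame l (m : line F 2) b (b0 : b != 0) :
  subline iota l -> [disjoint l & points_on linf] -> l \subset points_on m ->
  points_on m :&: points_on linf = [set pt b0] ->
  exists e f, [/\ [/\ h e = 1 & h f \notin codom iota], row_free (mat2 e f),
    l = image_flats iota (mat2 e f) 0 &
    exists2 nu, nu != 0 & h f *: e - f = nu *: b].
Proof.
case=> B Bf -> dis sub eqX.
have B2 := mat2_rows B; set e1 := row 0 B in B2; set f1 := row 1 B in B2.
have e10 : e1 != 0.
  apply/eqP => e0; have [||/eqP] := @mat2_free e1 f1 1 0.
  - by rewrite -B2.
  - by rewrite e0 scaler0 scale0r addr0.
  by rewrite oner_eq0.
have notin v (v0 : v != 0) : pt v0 \in image_flats iota B 0 -> h v != 0.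
  by move=> /(disjointFr dis); rewrite pt_points_on mem_linf => ->.
have he1 : h e1 != 0.
  apply: (notin _ e10); apply/mem_image_flats0; exists 1, (delta_mx 0 0).
  by rewrite scale1r map_delta_mx -rowE.
pose lam := (h e1)^-1; have lam0 : lam != 0 by rewrite invr_eq0.
pose e := lam *: e1; pose f := lam *: f1.
have BE : lam *: B = mat2 e f.
  apply/row_matrixP => i; rewrite linearZ /= [B in LHS]B2 !rowK.
  by case: i => [[|[|]]].
have BfE : row_free (mat2 e f) by rewrite -BE /row_free mxrank_scale_nz.
have lE : image_flats iota B 0 = image_flats iota (mat2 e f) 0.
  rewrite -BE -{2}[B]mul1mx -(map_mx1 iota).
  by rewrite image_flats_eq ?unitmx1.
have he : h e = 1 by rewrite lformZ mulVf.
have in_l v (v0 : v != 0) r s : v = iota r *: e + iota s *: f ->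
    pt v0 \in image_flats iota B 0.
  move=> vE; rewrite lE; apply/mem_image_flats0.
  exists 1, (\row_i [:: r; s]`_i).
  by rewrite scale1r mulmx_mat2 !mxE.
have in_m v r s : v = iota r *: e + iota s *: f -> v \in val m.
  move=> vE; have [->|v0] := eqVneq v 0; first exact: mem0v.
  by rewrite -(pt_points_on v0); apply: (subsetP sub); exact: in_l vE.
have em : e \in val m by apply: (in_m _ 1 0);
  rewrite rmorph1 rmorph0 scale1r scale0r addr0.
have fm : f \in val m by apply: (in_m _ 0 1);
  rewrite rmorph1 rmorph0 scale1r scale0r add0r.
have b'0 : h f *: e - f != 0.
  apply/eqP => b'E; have [|_ /eqP] := @mat2_free e f (h f) (- 1) BfE.
    by rewrite scaleN1r.
  by rewrite oppr_eq0 oner_eq0.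
have hb' : h (h f *: e - f) = 0.
  by rewrite lformD lformZ he -scaleN1r (lformZ (-1)); ring.
exists e, f; split=> //.
  split=> //; apply/codomP => -[k fk].
  have /notin/eqP[] : pt b'0 \in image_flats iota B 0 => //.
  by apply: (in_l _ _ k (-1)); rewrite fk rmorphN1 scaleN1r.
apply/(pt_eqP b'0 b0)/eqP/set1P; rewrite -eqX inE !pt_points_on mem_linf.
rewrite hb' eqxx andbT; apply: memvB => //; exact: memvZ.
Qed.

(** By [image_flats0_sub], [e] and [f] are [lam] times [K]-combinations of the rows of [A], while
    [a] is [lam'] times such a combination. Multiplying [a] by [lam / lam'] gives all three the same
    factor. *)
Lemma subplane_through A a e f (a0 : a != 0) : A \in unitmx ->
  h a = 0 -> h e = 1 -> indep a (h f *: e - f) -> row_free (mat2 e f) ->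
  image_flats iota (mat2 e f) 0 \subset image_flats iota A 0 ->
  pt a0 \in image_flats iota A 0 ->
  exists2 x, x != 0 &
    forall d, image_flats iota A d = image_flats iota (mat3 (x *: a) e f) d.
Proof.
move=> Au ha he ab Bf sub /mem_image_flats0[lam' [u aE]].
have [lam [U BE]] := image_flats0_sub Au Bf sub.
have lam0 : lam != 0.
  apply: contraTneq Bf => l0.
  by rewrite BE l0 scale0r /row_free mxrank0.
have lam'0 : lam' != 0 by apply: contraNneq (a0) => l0; rewrite aE l0 scale0r.
have x0 : lam / lam' != 0 by rewrite mulf_neq0 ?invr_eq0.
exists (lam / lam') => // d; set x := lam / lam'.
have Mu : mat3 (x *: a) e f \in unitmx.
  by apply: (@frame_unit _ _ _ (h f)); rewrite ?lformZ ?ha ?mulr0 //;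
    apply: indepZ.
pose G := mat3 u (row 0 U) (row 1 U).
have ME : mat3 (x *: a) e f = lam *: (G^f *m A).
  have rB i : row i (mat2 e f) = lam *: ((row i U)^f *m A).
    by rewrite BE linearZ /= row_mul map_row.
  have := rB 0; have := rB 1; rewrite !rowK /= => fE eE.
  apply/row_matrixP => i; rewrite rowK linearZ /= row_mul -map_row rowK.
  case: i => [[|[|[|]]] //= ?].
  by rewrite [in LHS]aE scalerA divfK.
rewrite ME image_flats_eq //.
by move: Mu; rewrite ME unitmxZ ?unitfE // unitmx_mul map_unitmx => /andP[].
Qed.

End Frames.

(** * Existence and uniqueness of the subplane *)

Section Main.
Local Open Scope ring_scope.

Lemma tangent_subplane_exists_unique (K F : finFieldType)
    (iota : {rmorphism K -> F}) (linf : line F 2) T S l (m : line F 2) X :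
  #|F| = (#|K| ^ 3)%N -> tangent_splash iota linf T S ->
  subline iota l -> [disjoint l & points_on linf] -> l \subset points_on m ->
  points_on m :&: points_on linf = [set X] -> X \in S :\ T ->
  exists! pi : configuration F,
    [/\ subplane iota pi,
        #|points pi :&: points_on linf| = 1%N,
        l \subset points pi
      & splash linf pi = S].
Proof.
move=> cardF S_splash l_subline l_linf l_m m_linf X_S.
have [c _ linfE] := hyperplaneP (eqP (valP linf)).
have [_ [[A Au ->] /= eqT SE]] := S_splash.
have [a [e0 [f0 [[ha he0 tK] A0u aT A0E]]]] := frame_exists linfE Au eqT.
rewrite -!A0E {A Au eqT A0E} in SE; set t := lform c f0 in tK.
have a0 : a != 0 := unit_mat3_neq0 A0u.
have {aT} TE : T = pt a0 by rewrite aT.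
have [x [x0 XE]] := pt_surj X; rewrite XE in X_S m_linf.
have SP0 v (v0 : v != 0) : pt v0 \in S <-> cone iota a (t *: e0 - f0) t v.
  by rewrite SE; exact: (pt_splash_frame linfE ha he0 erefl A0u tK).
have ab0 : indep a (t *: e0 - f0) := frame_indep A0u.
have /setD1P[XT /SP0[k [xE|[z0 z0t xE]]]] := X_S.
  case/eqP: XT; rewrite TE; apply/eqP/pt_eqP; exists k => //.
  by apply: contraNneq (x0) => k0; rewrite xE k0 scale0r.
(* The base point is moved to [X], so that the vector [t' *: e - f] obtained from the subline
   becomes a multiple [nu *: b]. *)
pose b := t *: e0 - f0 + z0 *: a.
have SP v (v0 : v != 0) : pt v0 \in S <-> cone iota a b t v.
  by rewrite SP0 cone_shift.
have ab : indep a b.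
  move=> y z yz; have [|yz0 z00] := ab0 (y + z * z0) z.
    by rewrite -[RHS]yz; apply/rowP => j; rewrite !mxE; ring.
  by move: yz0; rewrite z00 mul0r addr0.
have k0 : k != 0 by apply: contraNneq (x0) => k0; rewrite xE k0 scale0r.
have [e [f [[he t'K] Bf lE [nu' nu'0 b'E]]]] :=
  subline_frame linfE l_subline l_linf l_m m_linf.
rewrite xE -/b scalerA in b'E; set t' := lform c f in t'K b'E.
pose nu := nu' * k; have nu0 : nu != 0 by rewrite mulf_neq0.
have [mu mu0 mut] := Kplane_scale cardF tK t'K.
have munu0 : mu * nu != 0 by rewrite mulf_neq0.
have ab' y : y != 0 -> indep (y *: a) (t' *: e - f).
  move=> y0; apply: indepZ => // r s; rewrite b'E scalerA => /ab[-> /eqP].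
  by rewrite mulf_eq0 (negPf nu0) orbF => /eqP.
have hZa y : lform c (y *: a) = 0 by rewrite lformZ ha mulr0.
have Mu : mat3 ((mu * nu) *: a) e f \in unitmx.
  exact: (frame_unit (hZa _) he erefl (ab' _ munu0)).
(* The factor [mu * nu] is the one for which [cone_scale] identifies the splash of the new subplane
   with the given cone. *)
exists (Configuration (image_flats iota (mat3 ((mu * nu) *: a) e f) 0)
                 (image_flats iota (mat3 ((mu * nu) *: a) e f) 1)).
split.
  split; first by exists (mat3 ((mu * nu) *: a) e f).
  - by rewrite (frame_tangent linfE (hZa _) he erefl Mu t'K) cards1.
  - rewrite lE; apply/subsetP => P; have [v [v0 ->]] := pt_surj P.
    move=> /mem_image_flats0[lam [u vE]]; apply/mem_image_flats0.
    exists lam, (row3 0 (u 0 0) (u 0 1)); rewrite vE mulmx_mat2 mulmx_mat3 !mxE.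
    by rewrite rmorph0 scale0r add0r.
  apply/setP => P; have [v [v0 ->]] := pt_surj P; apply/idP/idP.
    move=> /(pt_splash_frame linfE (hZa _) he erefl Mu t'K) Cv.
    by apply/SP/(cone_scale a b v tK t'K mu0 nu0 mut); rewrite -b'E.
  move=> /SP Cv; apply/(pt_splash_frame linfE (hZa _) he erefl Mu t'K).
  by rewrite -/t' b'E; apply/(cone_scale a b v tK t'K mu0 nu0 mut).
move=> _ [[A Au ->] /= /eqP/cards1P[T' eqT'] lA SA].
(* The centre of a second subplane is recovered from the common splash. *)
have TT' : T' = T.
  have [a' [e' [f' [[ha' he' t''K] A'u a'T A'E]]]] :=
    frame_exists linfE Au eqT'.
  rewrite -!A'E in SA; have a'0 : a' != 0 := unit_mat3_neq0 A'u.
  have ab'' : indep a' (lform c f' *: e' - f') := frame_indep A'u.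
  rewrite -(a'T a'0) TE; apply/eqP/pt_eqP.
  apply: (cone_centre_unique cardF tK ab ab'' a'0) => v v0.
  rewrite -(SP _ v0) -SA.
  exact: (pt_splash_frame linfE ha' he' erefl A'u t''K).
have aA : pt a0 \in image_flats iota A 0.
  by have := set11 T'; rewrite -eqT' TT' TE inE => /andP[].
have ab1 := ab' 1 (oner_neq0 F); rewrite scale1r in ab1.
rewrite lE in lA; have [y y0 AE] := subplane_through Au ha he ab1 Bf lA aA.
have Nu : mat3 (y *: a) e f \in unitmx.
  exact: (frame_unit (hZa _) he erefl (ab' _ y0)).
(* Equality of the splashes makes [y / nu] another factor from [Kplane t'] to [Kplane t], so it is a
   [K]-multiple of [mu]. *)
have yt : {in Kplane iota t', forall z, y / nu * z \in Kplane iota t}.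
  apply: (cone_scale_sub ab nu0) => v v0; rewrite -b'E => Cv; apply/(SP _ v0).
  by rewrite -SA !AE; apply/(pt_splash_frame linfE (hZa _) he erefl Nu t'K).
have ynu0 : y / nu != 0 by rewrite mulf_neq0 ?invr_eq0.
have [r yE] := Kplane_scale_unique cardF tK t'K mu0 ynu0 mut yt.
have r0 : r != 0.
  by apply: contraNneq ynu0 => r0; rewrite yE r0 rmorph0 mul0r.
have {}yE : y = iota r * (mu * nu) by rewrite mulrA -yE divfK.
by rewrite !AE yE -[(iota r * _) *: a]scalerA !image_flats_mat3Z.
Qed.

End Main.

Theorem theorem5p1 (q : nat) (K F : finFieldType) (iota : {rmorphism K -> F})
    (q_prime_power : prime_power q) (cardK : #|K| = q) (cardF : #|F| = q ^ 3)
    (linf : line F 2) (T : point F 2) (S : {set point F 2})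
    (S_splash : tangent_splash iota linf T S)
    (l : {set point F 2}) (l_subline : subline iota l)
    (l_linf : [disjoint l & points_on linf])
    (m : line F 2) (l_m : l \subset points_on m)
    (X : point F 2) (m_linf : points_on m :&: points_on linf = [set X])
    (X_S : X \in S :\ T) :
  exists! pi : configuration F,
    [/\ subplane iota pi,
        #|points pi :&: points_on linf| = 1,
        l \subset points pi
      & splash linf pi = S].
Proof.
rewrite -cardK in cardF.
exact: (tangent_subplane_exists_unique cardF S_splash l_subline l_linf l_m m_linf
         X_S).
Qed.
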